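(* Let $(R,R_1,p,\mathfrak J_p,\boldsymbol\varphi,\boldsymbol\varphi_1)$ be an abstract spectral data tuple on a Hilbert space $\mathcal H$ (see context), and let $\Sigma^*:=\boldsymbol\varphi_1R_1R^{-1}\boldsymbol\varphi^*$ be the associated contraction. If $\Sigma^*$ is asymptotically stable, then there exists a unique Hankel operator $\Gamma$ on $\ell^2$ such that, with $\Gamma_1:=\Gamma S=S^*\Gamma$, $$\mathfrak C\Gamma=\mathcal V R\boldsymbol\varphi\mathfrak J_p\mathcal V^*,\qquad \mathfrak C\Gamma_1=\mathcal V R_1\boldsymbol\varphi_1\mathfrak J_p\mathcal V^*,\qquad \Gamma^*e_0=\mathcal V p$$ for some (linear) isometry $\mathcal V:\mathcal H\to\ell^2$. Furthermore, $\operatorname{Ker}\Gamma=\{0\}$ if and only if $\|R^{-1}p\|=1$ and $R^{-1}p\notin\operatorname{Ran}R$.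
   Context: All Hilbert spaces are complex and separable; inner products are linear in the first argument. $\ell^2=\ell^2(\mathbb Z_+)$ has standard basis $(e_k)_{k\ge0}$, $S$ is the forward shift on $\ell^2$, $S^*$ the backward shift. A Hankel operator is a bounded linear operator $\Gamma$ on $\ell^2$ with $\Gamma S=S^*\Gamma$, equivalently with matrix $(\gamma_{j+k})_{j,k\ge0}$. $\mathfrak C$ is the canonical conjugation on $\ell^2$ (entrywise complex conjugation). A conjugation on $\mathcal H$ is a conjugate-linear, isometric map $\mathfrak J$ with $\mathfrak J^2=I$. A bounded operator $T$ is $\mathfrak J$-symmetric if $T^*=\mathfrak JT\mathfrak J$. For a vector $p$, $pp^*$ denotes the operator $x\mapsto\langle x,p\rangle p$. An abstract spectral data tuple $(R,R_1,p,\mathfrak J_p,\boldsymbol\varphi,\boldsymbol\varphi_1)$ on $\mathcal H$ consists of: (i) bounded self-adjoint operators $R,R_1\ge0$ on $\mathcal H$ with $\operatorname{Ker}R=\{0\}$ and a vector $p\in\mathcal H$ with $R^2-R_1^2=pp^*$ (this implies $p\in\operatorname{Ran}R$ and $\|R^{-1}p\|\le1$); (ii) a conjugation $\mathfrak J_p$ on $\mathcal H$ commuting with $R$ and $R_1$ and with $\mathfrak J_pp=p$; (iii) a $\mathfrak J_p$-symmetric unitary operator $\boldsymbol\varphi$ commuting with $R$; (iv) a $\mathfrak J_p$-symmetric partial isometry $\boldsymbol\varphi_1$ commuting with $R_1$, with $\operatorname{Ker}\boldsymbol\varphi_1=\operatorname{Ker}R_1$. $R^{-1}$ is the densely defined inverse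 with domain $\operatorname{Ran}R$. Since $R_1^2\le R^2$, the operator $R_1R^{-1}$, defined on $\operatorname{Ran}R$, extends to a contraction on $\mathcal H$, and $\Sigma^*=\boldsymbol\varphi_1R_1R^{-1}\boldsymbol\varphi^*$ denotes the resulting contraction. A bounded operator $T$ is asymptotically stable if $\|T^nx\|\to0$ as $n\to\infty$ for every $x$. *)

(* Defs.v *)
From HB Require Import structures.
From mathcomp Require Import all_boot all_order all_algebra.
From mathcomp Require Import complex.
From mathcomp Require Import all_classical all_reals topology normedtype.
From mathcomp Require Import sequences.
From mathcomp Require Import ring lra.

Set Implicit Arguments.
Unset Strict Implicit.
Unset Printing Implicit Defensive.

Import Order.TTheory GRing.Theory Num.Theory.
Import numFieldNormedType.Exports.

Local Open Scope classical_set_scope.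
Local Open Scope ring_scope.
Local Open Scope complex_scope.

(* The complex numbers are F[i]; the norm of a normedModType F[i] takes its
   values in the nonnegative real elements of F[i]. *)
HB.mixin Record NormedModule_hasDot (F : realType) H
    & NormedModule F[i] H := {
  dotp : H -> H -> F[i] ;
  dotp_linearl : forall (a : F[i]) (x y z : H),
    dotp (a *: x + y) z = a * dotp x z + dotp y z ;
  dotp_conj : forall x y : H, dotp y x = (dotp x y)^* ;
  dotp_norm : forall x : H, dotp x x = `|x| ^+ 2
}.

#[short(type="hilbertType")]
HB.structure Definition Hilbert (F : realType) :=
  {H of CompleteNormedModule F[i] H & NormedModule_hasDot F H}.

Notation "''[' x , y ]" := (dotp x y) : ring_scope.

Definition separable_space (T : topologicalType) :=
  exists2 A : set T, countable A & dense A.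

Section SquareSummable.
Variable F : realType.
Implicit Types (z : F[i]) (u v : nat -> F[i]).

Definition sqmod z : F := Normc.normc z ^+ 2.

Definition square_summable u := cvgn (series (fun k => sqmod (u k))).

Lemma sqmodE z : sqmod z = complex.Re z ^+ 2 + complex.Im z ^+ 2.
Proof. by case: z => a b; rewrite /sqmod /= sqr_sqrtr ?addr_ge0 ?sqr_ge0. Qed.

Lemma sqmod_ge0 z : 0 <= sqmod z. Proof. exact: sqr_ge0. Qed.

Lemma sqmodM z z' : sqmod (z * z') = sqmod z * sqmod z'.
Proof. by rewrite /sqmod Normc.normcM exprMn. Qed.

Lemma sqmod_eq0 z : sqmod z = 0 -> z = 0.
Proof. by move/eqP; rewrite sqrf_eq0 => /eqP/Normc.eq0_normc. Qed.

Lemma sqmod0 : sqmod 0 = 0.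
Proof. by rewrite sqmodE /= expr0n addr0. Qed.

Lemma sqmodN z : sqmod (- z) = sqmod z.
Proof. by case: z => a b; rewrite !sqmodE /= !sqrrN. Qed.

Lemma sqmodD (c : F) z z' : 0 < c ->
  sqmod (z + z') <= (1 + c) * sqmod z + (1 + c^-1) * sqmod z'.
Proof.
move=> c0; case: z z' => [a b] [a' b']; rewrite !sqmodE /= -subr_ge0.
have -> : (1 + c) * (a ^+ 2 + b ^+ 2) + (1 + c^-1) * (a' ^+ 2 + b' ^+ 2) -
   ((a + a') ^+ 2 + (b + b') ^+ 2) =
   c^-1 * ((c * a - a') ^+ 2 + (c * b - b') ^+ 2).
  by field; rewrite gt_eqF.
by rewrite mulr_ge0 ?invr_ge0 ?(ltW c0) ?addr_ge0 ?sqr_ge0.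
Qed.

Lemma sqmodD2 z z' : sqmod (z + z') <= 2 * sqmod z + 2 * sqmod z'.
Proof. by have := @sqmodD 1 z z' ltr01; rewrite invr1. Qed.

Lemma sqsum_nondecr u :
  {homo series (fun k => sqmod (u k)) : n m / (n <= m)%N >-> n <= m}.
Proof. by apply: nondecreasing_series => n _ _; exact: sqmod_ge0. Qed.

Lemma square_summable_bounded u (M : F) :
  (forall n, series (fun k => sqmod (u k)) n <= M) -> square_summable u.
Proof.
move=> uM; apply: nondecreasing_is_cvgn; first exact: sqsum_nondecr.
by exists M => _ [n _ <-].
Qed.

Lemma sqsum_le u n : square_summable u ->
  series (fun k => sqmod (u k)) n <= limn (series (fun k => sqmod (u k))).
Proof. by move=> uE; apply: nondecreasing_cvgn_le => //; exact: sqsum_nondecr. Qed.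

Definition l2_pred : {pred nat -> F[i]} := fun u => `[< square_summable u >].

Lemma l2_predP u : reflect (square_summable u) (u \in l2_pred).
Proof. exact: asboolP. Qed.

Lemma square_summable_submod : submod_closed l2_pred.
Proof.
split=> [|a u v].
  apply/l2_predP; apply: (@square_summable_bounded _ 0) => n.
  by rewrite /series/= big1// => k _; exact: sqmod0.
move=> /l2_predP uE /l2_predP vE; apply/l2_predP.
pose l w := limn (series (fun k => sqmod (w k))).
apply: (@square_summable_bounded _ (2 * sqmod a * l u + 2 * l v)) => n.
apply: (@le_trans _ _ (\sum_(0 <= k < n)
   (2 * sqmod a * sqmod (u k) + 2 * sqmod (v k)))).
  by apply: ler_sum => k _; rewrite -mulrA -sqmodM; exact: sqmodD2.
rewrite big_split /= -!mulr_sumr.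
apply: lerD; apply: ler_wpM2l; rewrite ?(sqsum_le n uE) ?(sqsum_le n vE)//.
by apply: mulr_ge0 => //; exact: sqmod_ge0.
Qed.

HB.instance Definition _ :=
  GRing.isSubmodClosed.Build _ _ l2_pred square_summable_submod.

Lemma cvg_series_lin (a b : F) (f g : nat -> F) :
  cvgn (series f) -> cvgn (series g) ->
  series (fun k => a * f k + b * g k) @ \oo -->
    a * limn (series f) + b * limn (series g).
Proof.
move=> cf cg.
rewrite (_ : series _ = (fun n => a * series f n + b * series g n)).
  by apply: cvgD; apply: cvgM => //; exact: cvg_cst.
by apply/funext => n; rewrite /series/= big_split /= !mulr_sumr.
Qed.

Lemma cvg_series_eq (f g : nat -> F) (l : F) : f =1 g ->
  series f @ \oo --> l -> series g @ \oo --> l.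
Proof. by move=> /funext->. Qed.

Lemma is_cvg_ReM u v : square_summable u -> square_summable v ->
  cvgn (series (fun k => complex.Re (u k * (v k)^*))).
Proof.
move=> uE vE; apply: normed_cvg.
have cuv : cvgn (series (fun k => 1 * sqmod (u k) + 1 * sqmod (v k))).
  by apply/cvg_ex; eexists; apply: cvg_series_lin uE vE.
apply: series_le_cvg cuv => n; rewrite /= ?normr_ge0 //.
  by rewrite !mul1r addr_ge0 ?sqmod_ge0.
rewrite !sqmodE; case: (u n) => a b; case: (v n) => c d /=.
have := (sqr_ge0 (a + c), sqr_ge0 (a - c), sqr_ge0 (b + d), sqr_ge0 (b - d)).
have := (sqr_ge0 a, sqr_ge0 b, sqr_ge0 c, sqr_ge0 d).
rewrite !sqrrD ?sqrrN => -[[[? ?] ?] ?] [[[? ?] ?] ?].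
by rewrite ler_norml; apply/andP; split; lra.
Qed.

Lemma is_cvg_ImM u v : square_summable u -> square_summable v ->
  cvgn (series (fun k => complex.Im (u k * (v k)^*))).
Proof.
move=> uE vE; apply: normed_cvg.
have cuv : cvgn (series (fun k => 1 * sqmod (u k) + 1 * sqmod (v k))).
  by apply/cvg_ex; eexists; apply: cvg_series_lin uE vE.
apply: series_le_cvg cuv => n; rewrite /= ?normr_ge0 //.
  by rewrite !mul1r addr_ge0 ?sqmod_ge0.
rewrite !sqmodE; case: (u n) => a b; case: (v n) => c d /=.
have := (sqr_ge0 (a + d), sqr_ge0 (a - d), sqr_ge0 (b + c), sqr_ge0 (b - c)).
have := (sqr_ge0 a, sqr_ge0 b, sqr_ge0 c, sqr_ge0 d).
rewrite !sqrrD ?sqrrN => -[[[? ?] ?] ?] [[[? ?] ?] ?].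
by rewrite ler_norml; apply/andP; split; lra.
Qed.

End SquareSummable.
Arguments cvg_series_lin {F} a b {f g}.

Section L2.
Variable F : realType.

Record l2 : Type := L2 { l2_val :> nat -> F[i] ; l2_subproof : l2_val \in @l2_pred F }.

HB.instance Definition _ := [isSub for l2_val].
HB.instance Definition _ := [Choice of l2 by <:].
HB.instance Definition _ := [SubChoice_isSubLmodule of l2 by <:].

Implicit Types u v w : l2.

Lemma l2P u : square_summable u.
Proof. exact/l2_predP/l2_subproof. Qed.
Arguments l2P : clear implicits.

Lemma l2_ext u v : (forall k, u k = v k) -> u = v.
Proof. by move=> uv; apply/val_inj/funext. Qed.

Lemma l2_valP (a : F[i]) u v k : (a *: u + v) k = a * u k + v k.
Proof. by []. Qed.

Definition l2_sqnorm u : F := limn (series (fun k => sqmod (u k))).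

Definition l2_norm u : F[i] := (Num.sqrt (l2_sqnorm u))%:C.

Definition l2_dot u v : F[i] :=
  limn (series (fun k => complex.Re (u k * (v k)^*))) +i*
  limn (series (fun k => complex.Im (u k * (v k)^*))).

Lemma l2_sqnorm_ge0 u : 0 <= l2_sqnorm u.
Proof.
by have := sqsum_le 0 (l2P u); rewrite {1}/series /= big_geq.
Qed.

Lemma l2_sqnorm_le u (M : F) :
  (forall n, series (fun k => sqmod (u k)) n <= M) -> l2_sqnorm u <= M.
Proof. by move=> uM; apply: limr_le; [exact: l2P|exact: nearW]. Qed.

Lemma l2_sqnorm_eq0 u : l2_sqnorm u = 0 -> u = 0.
Proof.
move=> u0; apply: l2_ext => k; apply: sqmod_eq0; apply/le_anti.
rewrite sqmod_ge0 andbT -u0; apply: (le_trans _ (sqsum_le k.+1 (l2P u))).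
rewrite /series/= big_nat_recr//= lerDr.
by apply: sumr_ge0 => j _; exact: sqmod_ge0.
Qed.

Lemma l2_norm_eq0 u : l2_norm u = 0 -> u = 0.
Proof.
move=> /(congr1 (@complex.Re F))/= /eqP; rewrite sqrtr_eq0 => u0.
by apply: l2_sqnorm_eq0; apply/le_anti; rewrite u0 l2_sqnorm_ge0.
Qed.

Lemma l2_normZ (a : F[i]) u : l2_norm (a *: u) = `|a| * l2_norm u.
Proof.
have -> : `|a| = (Normc.normc a)%:C by [].
rewrite /l2_norm -rmorphM /=; congr (_%:C).
suff -> : l2_sqnorm (a *: u) = Normc.normc a ^+ 2 * l2_sqnorm u.
  rewrite sqrtrM ?sqr_ge0// sqrtr_sqr ger0_norm//.
  by case: (a) => ? ?; exact: sqrtr_ge0.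
apply/cvg_lim => //; have := cvg_series_lin (sqmod a) 0 (l2P u) (l2P u).
by rewrite mul0r addr0; apply: cvg_series_eq => k; rewrite mul0r addr0 -sqmodM.
Qed.

Lemma l2_normD u v : l2_norm (u + v) <= l2_norm u + l2_norm v.
Proof.
rewrite /l2_norm -rmorphD /= lecR.
set s := Num.sqrt (l2_sqnorm u); set t := Num.sqrt (l2_sqnorm v).
have s_ge0 : 0 <= s by exact: sqrtr_ge0.
have t_ge0 : 0 <= t by exact: sqrtr_ge0.
have Es : l2_sqnorm u = s ^+ 2 by rewrite sqr_sqrtr ?l2_sqnorm_ge0.
have Et : l2_sqnorm v = t ^+ 2 by rewrite sqr_sqrtr ?l2_sqnorm_ge0.
have [s0|s_neq0] := eqVneq s 0.
  have -> : u = 0 by apply: l2_sqnorm_eq0; rewrite Es s0 expr0n.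
  by rewrite add0r s0 add0r.
have [t0|t_neq0] := eqVneq t 0.
  have -> : v = 0 by apply: l2_sqnorm_eq0; rewrite Et t0 expr0n.
  by rewrite addr0 t0 addr0.
have s_gt0 : 0 < s by rewrite lt_neqAle eq_sym s_neq0.
have t_gt0 : 0 < t by rewrite lt_neqAle eq_sym t_neq0.
rewrite -[leRHS]ger0_norm ?addr_ge0// -sqrtr_sqr ler_wsqrtr//.
apply: l2_sqnorm_le => n.
apply: (@le_trans _ _ (\sum_(0 <= k < n)
    ((1 + t / s) * sqmod (u k) + (1 + (t / s)^-1) * sqmod (v k)))).
  by apply: ler_sum => k _; apply: sqmodD; rewrite divr_gt0.
rewrite big_split /= -!mulr_sumr.
have -> : (s + t) ^+ 2 =
    (1 + t / s) * l2_sqnorm u + (1 + (t / s)^-1) * l2_sqnorm v.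
  by rewrite Es Et; field; rewrite s_neq0.
apply: lerD; apply: ler_wpM2l.
- by rewrite addr_ge0// divr_ge0.
- exact: (sqsum_le n (l2P u)).
- by rewrite addr_ge0// invr_ge0 divr_ge0.
- exact: (sqsum_le n (l2P v)).
Qed.

HB.instance Definition _ :=
  Lmodule_isNormed.Build F[i] l2 l2_normD l2_normZ l2_norm_eq0.

Lemma l2_dot_linearl (a : F[i]) u v w :
  l2_dot (a *: u + v) w = a * l2_dot u w + l2_dot v w.
Proof.
have cR := is_cvg_ReM (l2P u) (l2P w); have cI := is_cvg_ImM (l2P u) (l2P w).
have dR := is_cvg_ReM (l2P v) (l2P w); have dI := is_cvg_ImM (l2P v) (l2P w).
case: a => a b; rewrite /l2_dot; simpc; congr (_ +i* _); apply/cvg_lim => //.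
- have c1 := cvg_series_lin a (- b) cR cI.
  have c2 := cvg_series_lin 1 1 (cvgP _ c1) dR.
  rewrite !mul1r (cvg_lim _ c1)// mulNr in c2.
  move: c2; apply: cvg_series_eq => k.
  rewrite l2_valP !mul1r.
  by case: (u k) (v k) (w k) => [? ?] [? ?] [? ?] /=; ring.
- have c1 := cvg_series_lin a b cI cR.
  have c2 := cvg_series_lin 1 1 (cvgP _ c1) dI.
  rewrite !mul1r (cvg_lim _ c1)// in c2.
  move: c2; apply: cvg_series_eq => k.
  rewrite l2_valP !mul1r.
  by case: (u k) (v k) (w k) => [? ?] [? ?] [? ?] /=; ring.
Qed.

Lemma l2_dot_conj u v : l2_dot v u = (l2_dot u v)^*.
Proof.
rewrite /l2_dot /=; congr (_ +i* _).
  congr (lim (series _ @ \oo)); apply/funext => k.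
  by case: (u k) (v k) => [? ?] [? ?] /=; ring.
have cI := is_cvg_ImM (l2P u) (l2P v).
apply/cvg_lim => //; have := cvg_series_lin (-1) 0 cI cI.
rewrite mul0r addr0 mulN1r; apply: cvg_series_eq => k.
by case: (u k) (v k) => [? ?] [? ?] /=; ring.
Qed.

Lemma l2_dot_norm u : l2_dot u u = `|u| ^+ 2.
Proof.
have -> : `|u| = l2_norm u by [].
rewrite /l2_norm -rmorphXn /= sqr_sqrtr ?l2_sqnorm_ge0// /l2_dot.
congr (_ +i* _).
  congr (lim (series _ @ \oo)); apply/funext => k; rewrite sqmodE.
  by case: (u k) => [? ?] /=; ring.
rewrite (_ : series _ = cst 0) ?lim_cst//; apply/funext => n.
by rewrite /series/= big1// => k _; case: (u k) => [? ?] /=; ring.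
Qed.

Lemma l2_ballE u v (e : F) :
  0 < e -> ball u e%:C v -> forall n,
  series (fun k => sqmod (u k - v k)) n <= e ^+ 2.
Proof.
move=> e0; rewrite -ball_normE /= => uv n.
have {}uv : Num.sqrt (l2_sqnorm (u - v)) < e by rewrite -ltcR.
apply: (le_trans (sqsum_le n (l2P (u - v)))).
rewrite -/(l2_sqnorm _) -(sqr_sqrtr (l2_sqnorm_ge0 _)).
by rewrite ler_sqr ?nnegrE ?sqrtr_ge0 ?ltW.
Qed.

Lemma sqmod_coord_le u (e : F) k : 
  (forall n, series (fun k => sqmod (u k)) n <= e ^+ 2) -> sqmod (u k) <= e ^+ 2.
Proof.
move=> /(_ k.+1); apply: le_trans; rewrite /series/= big_nat_recr//= lerDr.
by apply: sumr_ge0 => j _; exact: sqmod_ge0.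
Qed.

Lemma l2_coord_cvg (G : set_system l2) (g : F[i] -> F) k :
  ProperFilter G -> cauchy G ->
  (forall z z', (g z - g z') ^+ 2 <= sqmod (z - z')) ->
  cvg ((fun x : l2 => g (x k)) @ G).
Proof.
move=> PG /cauchy_ballP cG gle; apply: cauchy_cvg; apply/cauchyP => e e0.
have /cauchyP/(_ (e / 2)%:C) : cauchy G by exact/cauchy_ballP.
case; first by rewrite ltcR divr_gt0.
move=> x Gx; exists (g (x k)).
change (G [set y : l2 | ball (g (x k)) e (g (y k))]).
apply: filterS Gx => y xy /=.
have e20 : 0 < e / 2 by rewrite divr_gt0.
have xyk := @sqmod_coord_le (x - y) _ k (l2_ballE e20 xy); rewrite -ball_normE /=.
have e2 : 0 <= e / 2 by rewrite divr_ge0 ?ltW.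
apply: (@le_lt_trans _ _ (e / 2)); last by rewrite ltr_pdivrMr// ltr_pMr// ltr1n.
rewrite -(@ler_pXn2r _ 2) ?nnegrE// real_normK ?num_real//.
exact: le_trans (gle _ _) xyk.
Qed.

Lemma l2_complete (G : set_system l2) : ProperFilter G -> cauchy G -> cvg G.
Proof.
move=> PG cG.
pose g1 := @complex.Re F; pose g2 := @complex.Im F.
have g1le z z' : (g1 z - g1 z') ^+ 2 <= sqmod (z - z').
  by rewrite sqmodE; case: z z' => [? ?] [? ?] /=; rewrite lerDl sqr_ge0.
have g2le z z' : (g2 z - g2 z') ^+ 2 <= sqmod (z - z').
  by rewrite sqmodE; case: z z' => [? ?] [? ?] /=; rewrite lerDr sqr_ge0.
pose w k : F[i] := lim ((fun x : l2 => g1 (x k)) @ G) +i*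
                   lim ((fun x : l2 => g2 (x k)) @ G).
have cw (x : l2) n : (fun y : l2 => series (fun k => sqmod (x k - y k)) n) @ G -->
    series (fun k => sqmod (x k - w k)) n.
  apply: cvg_big => [|k _]; first exact: add_continuous.
  under eq_fun do rewrite sqmodE; rewrite sqmodE.
  have E (a b : F[i]) : (complex.Re (a - b) = g1 a - g1 b) *
                        (complex.Im (a - b) = g2 a - g2 b).
    by case: a b => [? ?] [? ?].
  under eq_fun do rewrite !E; rewrite !E.
  by apply: cvgD; rewrite !expr2; under eq_fun do rewrite expr2;
    apply: cvgM; apply: cvgB; try exact: cvg_cst;
    apply: l2_coord_cvg.
have near_w (e : F) : 0 < e -> G [set x : l2 | forall n,
    series (fun k => sqmod (x k - w k)) n <= e ^+ 2].
  move=> e0; have /cauchyP/(_ (e / 2)%:C) := cG.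
  case; first by rewrite ltcR divr_gt0.
  move=> z Gz; near=> x => n.
  rewrite -(cvg_lim _ (cw x n))//; apply: limr_le; first exact: (cvgP _ (cw x n)).
  near=> y; apply: l2_ballE => //.
  have -> : e%:C = (e / 2)%:C + (e / 2)%:C :> F[i].
    by rewrite -rmorphD/= -splitr.
  by apply: (@ball_triangle _ _ z); [apply: ball_sym; near: x|near: y].
have [x xw] : exists x : l2, forall n,
    series (fun k => sqmod (x k - w k)) n <= 1 ^+ 2.
  exact: filter_ex (near_w 1 ltr01).
have xwE : ((fun k => x k - w k) : nat -> F[i]) \in @l2_pred F.
  by apply/l2_predP; exact: square_summable_bounded xw.
pose W : l2 := x - L2 xwE.
have WE k : W k = w k by rewrite -[LHS]/(x k - (x k - w k)) opprB addrC subrK.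
apply/cvg_ex; exists W; apply/cvg_ballP => e e0.
have [r r0 re] : exists2 r : F, 0 < r & r%:C = e.
  case: e e0 => a b; rewrite ltcE /= => /andP[/eqP-> a0]; by exists a.
have r20 : 0 < r / 2 by rewrite divr_gt0.
apply: filterS (near_w _ r20) => y yw; apply: ball_sym; rewrite -ball_normE /= -re.
suff : Num.sqrt (l2_sqnorm (y - W)) < r by rewrite -ltcR.
apply: (@le_lt_trans _ _ (r / 2)); last by rewrite ltr_pdivrMr// ltr_pMr// ltr1n.
rewrite -(ger0_norm (ltW r20)) -sqrtr_sqr ler_wsqrtr//.
apply: l2_sqnorm_le => n; apply: le_trans (yw n).
by apply: ler_sum => k _; rewrite -[(y - W) k]/(y k - W k) WE.
Unshelve. all: by end_near.
Qed.

HB.instance Definition _ := Uniform_isComplete.Build l2 l2_complete.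
HB.instance Definition _ := NormedModule_hasDot.Build F l2
  l2_dot_linearl l2_dot_conj l2_dot_norm.

Definition basis_fun (j : nat) : nat -> F[i] := fun k => (k == j)%:R.
Definition shift_fun (u : nat -> F[i]) : nat -> F[i] :=
  fun k => if k is k'.+1 then u k' else 0.
Definition bshift_fun (u : nat -> F[i]) : nat -> F[i] := fun k => u k.+1.
Definition conj_fun (u : nat -> F[i]) : nat -> F[i] := fun k => (u k)^*.

Lemma basis_fun_l2 j : basis_fun j \in @l2_pred F.
Proof.
apply/l2_predP; apply: (@square_summable_bounded _ _ (sqmod 1)) => n.
rewrite /series /=; have [jn|nj] := ltnP j n.
  rewrite (bigD1_seq j) ?mem_iota ?iota_uniq ?subn0//= big1 ?addr0 => [|k kj].
    by rewrite /basis_fun eqxx.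
  by rewrite /basis_fun (negbTE kj) sqmod0.
rewrite big_nat big1 ?sqmod_ge0// => k /= kn.
by rewrite /basis_fun ltn_eqF ?sqmod0// (leq_trans kn).
Qed.

Lemma series_shift (f : F[i] -> F) (u : nat -> F[i]) n : f 0 = 0 ->
  series (fun k => f (shift_fun u k)) n.+1 = series (fun k => f (u k)) n.
Proof. by move=> f0; rewrite /series /= big_nat_recl//= f0 add0r. Qed.

Lemma shift_fun_l2 u : shift_fun u \in @l2_pred F.
Proof.
apply/l2_predP; apply: (@square_summable_bounded _ _ (l2_sqnorm u)) => -[|n].
  by rewrite /series /= big_geq// l2_sqnorm_ge0.
rewrite series_shift; [exact: (sqsum_le n (l2P u)) | exact: sqmod0].
Qed.

Lemma bshift_fun_l2 u : bshift_fun u \in @l2_pred F.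
Proof.
apply/l2_predP; apply: (@square_summable_bounded _ _ (l2_sqnorm u)) => n.
apply: le_trans (sqsum_le n.+1 (l2P u)).
by rewrite /series /= big_nat_recl//= lerDr sqmod_ge0.
Qed.

Lemma conj_fun_l2 u : conj_fun u \in @l2_pred F.
Proof.
apply/l2_predP; apply: (@square_summable_bounded _ _ (l2_sqnorm u)) => n.
apply: le_trans (sqsum_le n (l2P u)); apply: ler_sum => k _.
by rewrite /conj_fun !sqmodE; case: (u k) => a b /=; rewrite sqrrN.
Qed.

Definition l2_basis j : l2 := L2 (basis_fun_l2 j).
Definition fshift u : l2 := L2 (shift_fun_l2 u).
Definition bshift u : l2 := L2 (bshift_fun_l2 u).
Definition l2_conj u : l2 := L2 (conj_fun_l2 u).

Lemma bshift_adjoint u v : '[fshift u, v] = '[u, bshift v].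
Proof.
have E (g : F[i] -> F) : g 0 = 0 ->
    cvgn (series (fun k => g (fshift u k * (v k)^*))) ->
    limn (series (fun k => g (fshift u k * (v k)^*))) =
    limn (series (fun k => g (u k * (bshift v k)^*))).
  move=> g0 cg; apply/esym/cvg_lim => //.
  rewrite (_ : series _ =
    [sequence series (fun k => g (fshift u k * (v k)^*)) n.+1]_n).
    by move: cg; rewrite -cvg_shiftS.
  by apply/funext => n; rewrite /series /= big_nat_recl//= mul0r g0 add0r.
congr (_ +i* _); apply: E => //.
  exact: is_cvg_ReM (l2P _) (l2P _).
exact: is_cvg_ImM (l2P _) (l2P _).
Qed.

End L2.

Section Operators.
Variables (F : realType) (H K : hilbertType F).
Implicit Types T : H -> K.

Definition bounded_op T :=
  linear T /\ exists M : F, forall x, `|T x| <= M%:C * `|x|.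

Definition linear_isometry T := linear T /\ forall x, `|T x| = `|x|.

Definition op_ker T : set H := [set x | T x = 0].

(* By the Riesz representation theorem the adjoint of a bounded T exists, and
   adjE below shows that it is unique; the default value is never reached. *)
Definition adj T : K -> H :=
  xget (fun=> 0) [set T' | forall x y, '[T x, y] = '[x, T' y]].

End Operators.

Section Adjoint.
Variables (F : realType) (H K : hilbertType F).

Lemma dotp_injr (x y : H) : (forall z, '[z, x] = '[z, y]) -> x = y.
Proof.
move=> xy; apply/eqP; rewrite -subr_eq0 -normr_eq0 -sqrf_eq0 -dotp_norm.
have := dotp_linearl (-1) y x (x - y).
rewrite scaleN1r mulN1r [- y + x]addrC => ->.
have -> z : '[y, z] = '[x, z] by rewrite (dotp_conj z y) -xy -dotp_conj.
by rewrite addNr.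
Qed.

Lemma adjE (T : H -> K) (T' : K -> H) :
  (forall x y, '[T x, y] = '[x, T' y]) -> adj T = T'.
Proof.
move=> TT'; apply/funext => y; apply: dotp_injr => x; rewrite -TT'.
by rewrite /adj; case: xgetP => [A _ -> //|/(_ _ TT')].
Qed.

End Adjoint.

Lemma adj_shift (F : realType) : adj (@fshift F) = @bshift F.
Proof. exact/adjE/bshift_adjoint. Qed.

Section SpectralData.
Variables (F : realType) (H : hilbertType F).
Implicit Types (R T U J : H -> H) (p x y : H).

Definition self_adjoint T := bounded_op T /\ adj T = T.

Definition nonneg_op T := forall x, 0 <= '[T x, x].

Definition unitary U := [/\ bounded_op U, adj U \o U = id & U \o adj U = id].

Definition partial_isometry U := bounded_op U /\
  forall x, (forall y, op_ker U y -> '[x, y] = 0) -> `|U x| = `|x|.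

Definition conjugation J :=
  [/\ forall (a : F[i]) x y, J (a *: x + y) = a^* *: J x + J y,
      forall x, `|J x| = `|x| & J \o J = id].

Definition conj_symmetric J T := adj T = J \o T \o J.

Definition commuting (T T' : H -> H) := T \o T' = T' \o T.

Definition rank_one p : H -> H := fun x => '[x, p] *: p.

Record spectral_data R R1 p J phi phi1 : Prop := SpectralData {
  sd_R : self_adjoint R /\ nonneg_op R ;
  sd_R1 : self_adjoint R1 /\ nonneg_op R1 ;
  sd_kerR : op_ker R = [set 0] ;
  sd_rank_one : (R \o R) \- (R1 \o R1) = rank_one p ;
  sd_J : conjugation J ;
  sd_JR : commuting J R ;
  sd_JR1 : commuting J R1 ;
  sd_Jp : J p = p ;
  sd_phi : unitary phi /\ conj_symmetric J phi ;
  sd_phiR : commuting phi R ;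
  sd_phi1 : partial_isometry phi1 /\ conj_symmetric J phi1 ;
  sd_phi1R1 : commuting phi1 R1 ;
  sd_kerphi1 : op_ker phi1 = op_ker R1
}.

(* For injective R, the densely defined inverse, with junk value 0 off Ran R. *)
Definition inv_op R y : H := xget 0 [set x | R x = y].

(* The contraction on H extending R1 R^-1 from Ran R; for a spectral data tuple
   it exists since R1^2 <= R^2, and is unique since Ran R is dense. *)
Definition ext_R1Rinv R R1 : H -> H :=
  xget (fun=> 0) [set T : H -> H |
    [/\ linear T, forall x, `|T x| <= `|x| &
        forall y, range R y -> T y = R1 (inv_op R y)]].

Definition Sigma_star R R1 phi phi1 : H -> H :=
  phi1 \o ext_R1Rinv R R1 \o adj phi.

(* Convergence in the norm topology of H, i.e. `|T^n x| tends to 0. *)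
Definition asymptotically_stable T :=
  forall x, iter n T x @[n --> \oo] --> (0 : H).

End SpectralData.

Definition hankel (F : realType) (Gamma : l2 F -> l2 F) :=
  bounded_op Gamma /\ Gamma \o @fshift F = @bshift F \o Gamma.

(* Main.v *)
Require Import Defs.
From mathcomp Require Import all_boot all_order all_algebra.
From mathcomp Require Import complex.
From mathcomp Require Import all_classical all_reals topology normedtype.
From mathcomp Require Import sequences.
From mathcomp Require Import ring lra.

Set Implicit Arguments.
Unset Strict Implicit.
Unset Printing Implicit Defensive.

Import Order.TTheory GRing.Theory Num.Theory.
Import numFieldNormedType.Exports.

Local Open Scope classical_set_scope.
Local Open Scope ring_scope.
Local Open Scope complex_scope.

(** Put q = R^-1 p, v = phi q, T = Sigma^* and let A = R phi J, A1 = R1 phi1 J,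
    which are antilinear and symmetric: <A x, y> = <A y, x>. The contraction D
    extending R1 R^-1 satisfies D^* D = I - q q^*, and phi1 is isometric on the
    range of D, so |x|^2 = |<x, v>|^2 + |T x|^2. Summing along the orbit, V h =
    (<T^n h, v>)_n is an isometry when T is asymptotically stable, and S^* V =
    V T. Since T A = A1 = A T^* and A v = p, the operator Gamma = C V A V^* is
    Hankel and has all required properties. Conversely those properties force
    S^* V = V T on the dense range of A and V^* e_0 = v, hence determine V.

    Finally Ker Gamma = Ker V^*. If V is onto, then |q| = |V^* e_0| = 1 and T is
    onto, so that phi1^* and R1 are injective, while q = R w with |q| = 1 gives
    R1^2 w = 0. In the other direction R1 is injective, so phi1 is unitary,
    D D^* = I and T is onto with T v = 0, whence every e_n lies in the range of
    V. *)

Section LinearMaps.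
Variables (K : pzRingType) (U V : lmodType K) (T : U -> V).
Hypothesis Tlin : linear T.

Lemma linear_fun0 : T 0 = 0.
Proof. by have := Tlin (-1) 0 0; rewrite scaler0 addr0 scaleN1r addNr. Qed.

Lemma linear_funD x y : T (x + y) = T x + T y.
Proof. by have := Tlin 1 x y; rewrite !scale1r. Qed.

Lemma linear_funZ a x : T (a *: x) = a *: T x.
Proof. by have := Tlin a x 0; rewrite linear_fun0 !addr0. Qed.

Lemma linear_funB x y : T (x - y) = T x - T y.
Proof. by rewrite linear_funD -scaleN1r linear_funZ scaleN1r. Qed.

End LinearMaps.

Lemma linear_comp (K : pzRingType) (U V W : lmodType K) (S : V -> W)
  (T : U -> V) : linear S -> linear T -> linear (S \o T).
Proof. by move=> Sl Tl a x y /=; rewrite Tl Sl. Qed.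

(** * Inner products, squared norms and convergence *)

Section InnerProduct.
Variables (F : realType) (H : hilbertType F).
Implicit Types (x y z : H) (a : F[i]).

Lemma dotDl x y z : '[x + y, z] = '[x, z] + '[y, z].
Proof. by have := dotp_linearl 1 x y z; rewrite scale1r mul1r. Qed.

Lemma dot0l z : '[0 : H, z] = 0.
Proof.
by have := dotp_linearl (-1) 0 0 z; rewrite scaler0 addr0 mulN1r addNr.
Qed.

Lemma dotZl a x z : '[a *: x, z] = a * '[x, z].
Proof. by have := dotp_linearl a x 0 z; rewrite dot0l !addr0. Qed.

Lemma dotNl x z : '[- x, z] = - '[x, z].
Proof. by rewrite -scaleN1r dotZl mulN1r. Qed.

Lemma dotBl x y z : '[x - y, z] = '[x, z] - '[y, z].
Proof. by rewrite dotDl dotNl. Qed.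

Lemma dotDr x y z : '[z, x + y] = '[z, x] + '[z, y].
Proof. by rewrite dotp_conj dotDl rmorphD /= -!dotp_conj. Qed.

Lemma dot0r z : '[z, 0 : H] = 0.
Proof. by rewrite dotp_conj dot0l conjc0. Qed.

Lemma dotZr a x z : '[z, a *: x] = conjc a * '[z, x].
Proof. by rewrite dotp_conj dotZl rmorphM /= -dotp_conj. Qed.

Lemma dotNr x z : '[z, - x] = - '[z, x].
Proof. by rewrite dotp_conj dotNl rmorphN /= -dotp_conj. Qed.

Lemma dotBr x y z : '[z, x - y] = '[z, x] - '[z, y].
Proof. by rewrite dotDr dotNr. Qed.

(** The norm takes values in [F[i]]; this real square turns estimates into real arithmetic. *)
Definition sqnorm x : F := complex.Re '[x, x].

Lemma dotpp x : '[x, x] = (sqnorm x)%:C.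
Proof.
have := dotp_conj x x; rewrite /sqnorm; case: '[x, x] => a b [] /= /eqP.
rewrite -subr_eq0 opprK -mulr2n mulrn_eq0 /= => /eqP ->; exact: complexr0.
Qed.

Lemma sqnorm_ge0 x : 0 <= sqnorm x.
Proof. by rewrite -ler0c -dotpp dotp_norm exprn_ge0. Qed.

Lemma norm_sqnorm x : `|x| = (Num.sqrt (sqnorm x))%:C.
Proof.
apply/eqP; rewrite -(@eqrXn2 _ 2) ?normr_ge0// ?ler0c ?sqrtr_ge0//.
by rewrite -dotp_norm dotpp -rmorphXn /= sqr_sqrtr ?sqnorm_ge0.
Qed.

Lemma norm1_sqnorm x : `|x| = 1 <-> sqnorm x = 1.
Proof.
rewrite norm_sqnorm; split=> [[] s1|->]; last by rewrite sqrtr1.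
by rewrite -(sqr_sqrtr (sqnorm_ge0 x)) s1 expr1n.
Qed.

Lemma sqnorm_eq0 x : sqnorm x = 0 -> x = 0.
Proof. by move=> x0; apply/normr0_eq0; rewrite norm_sqnorm x0 sqrtr0. Qed.

Lemma sqnorm0 : sqnorm 0 = 0.
Proof. by rewrite /sqnorm dot0l. Qed.

Lemma sqnormN x : sqnorm (- x) = sqnorm x.
Proof. by rewrite /sqnorm dotNl dotNr opprK. Qed.

Lemma sqmod_conjE (c : F[i]) : c * conjc c = (sqmod c)%:C.
Proof. by rewrite sqmodE; case: c => a b; simpc; congr (_ +i* _); ring. Qed.

Lemma sqmod_conj (c : F[i]) : sqmod (conjc c) = sqmod c.
Proof. by rewrite !sqmodE; case: c => a b /=; rewrite sqrrN. Qed.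

Lemma sqnormZ a x : sqnorm (a *: x) = sqmod a * sqnorm x.
Proof.
apply: (@complexI F); rewrite -dotpp dotZl dotZr mulrA sqmod_conjE dotpp.
exact: (esym (rmorphM (real_complex F) _ _)).
Qed.

Lemma ReD (a b : F[i]) : complex.Re (a + b) = complex.Re a + complex.Re b.
Proof. by case: a => a1 a2; case: b => b1 b2. Qed.

Lemma ReN (a : F[i]) : complex.Re (- a) = - complex.Re a.
Proof. by case: a => [? ?]. Qed.

Lemma ReCM (t : F) (a : F[i]) : complex.Re (t%:C * a) = t * complex.Re a.
Proof. by case: a => [? ?] /=; rewrite mul0r subr0. Qed.

Lemma Re_conjc (a : F[i]) : complex.Re (conjc a) = complex.Re a.
Proof. by case: a => [? ?]. Qed.

Lemma sqnormD x y :
  sqnorm (x + y) = sqnorm x + 2 * complex.Re '[x, y] + sqnorm y.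
Proof.
rewrite /sqnorm dotDl !dotDr !ReD (dotp_conj x y) Re_conjc; ring.
Qed.

Lemma sqnormB x y :
  sqnorm (x - y) = sqnorm x - 2 * complex.Re '[x, y] + sqnorm y.
Proof. by rewrite sqnormD sqnormN dotNr ReN mulrN. Qed.

Lemma conj_realC (t : F) : conjc t%:C = t%:C.
Proof. exact: conjc_real. Qed.

(** The squared norm of [x - t y] is nonnegative; the [t] chosen below is the minimising real
    scalar. *)
Lemma Re_dot_sqr_le x y :
  complex.Re '[x, y] ^+ 2 <= sqnorm x * sqnorm y.
Proof.
have [y0|yn0] := eqVneq (sqnorm y) 0.
  by rewrite (sqnorm_eq0 y0) dot0r sqnorm0 mulr0 expr0n.
have y_gt0 : 0 < sqnorm y by rewrite lt_neqAle eq_sym yn0 sqnorm_ge0.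
set c := complex.Re _; pose t := c / sqnorm y.
have := sqnorm_ge0 (x - t%:C *: y).
rewrite sqnormB sqnormZ dotZr conj_realC ReCM -/c sqmodE /= expr0n addr0.
rewrite -(pmulr_lge0 _ y_gt0) -subr_ge0 => h.
rewrite -subr_ge0; apply: le_trans h _; rewrite subr0 le_eqVlt; apply/orP; left.
by apply/eqP; rewrite /t; field.
Qed.

(** Scaling [x] by the conjugate of ['[x, y]] makes the inner product real, which reduces
    Cauchy-Schwarz to its real form. *)
Lemma sqmod_dot_le (x y : H) : sqmod '[x, y] <= sqnorm x * sqnorm y.
Proof.
have [x0|xn0] := eqVneq '[x, y] 0.
  by rewrite x0 sqmod0 mulr_ge0 ?sqnorm_ge0.
have sp : 0 < sqmod '[x, y].
  by rewrite lt_neqAle sqmod_ge0 andbT eq_sym; apply/eqP => /sqmod_eq0/eqP; exact/negP.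
have := Re_dot_sqr_le (conjc '[x, y] *: x) y.
rewrite dotZl mulrC sqmod_conjE /= sqnormZ sqmod_conj expr2 -mulrA.
by rewrite ler_pM2l.
Qed.

Lemma dotp_injl (x y : H) : (forall z, '[x, z] = '[y, z]) -> x = y.
Proof. by move=> xy; apply: dotp_injr => z; rewrite dotp_conj xy -dotp_conj. Qed.

Lemma norm_lt_sqnorm x (r : F) : 0 < r -> (`|x| < r%:C) = (sqnorm x < r ^+ 2).
Proof.
move=> r0; rewrite norm_sqnorm ltcR -[in RHS](sqr_sqrtr (sqnorm_ge0 x)).
by rewrite ltr_pXn2r// nnegrE ?sqrtr_ge0// ltW.
Qed.

Lemma pos_complexP (e : F[i]) : 0 < e -> exists2 r : F, 0 < r & e = r%:C.
Proof. by case: e => a b; rewrite ltcE /= => /andP[/eqP-> a0]; exists a. Qed.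

Lemma cvg_sqnormP (u : nat -> H) z :
  u @ \oo --> z <-> forall e : F, 0 < e -> \forall n \near \oo, sqnorm (u n - z) < e.
Proof.
split=> [/cvgrPdist_lt uz e e0|uz].
  have se0 : 0 < Num.sqrt e by rewrite sqrtr_gt0.
  have /uz : 0 < (Num.sqrt e)%:C by rewrite ltcR.
  apply: filterS => n.
  by rewrite distrC norm_lt_sqnorm// sqr_sqrtr// ltW.
apply/cvgrPdist_lt => _ /pos_complexP[r r0 ->].
apply: filterS (uz (r ^+ 2) (exprn_gt0 _ r0)) => n.
by rewrite distrC norm_lt_sqnorm.
Qed.

Lemma cauchy_sqnorm (u : nat -> H) :
  (forall e : F, 0 < e -> exists N, forall n, (N <= n)%N -> sqnorm (u N - u n) < e) ->
  exists z, u @ \oo --> z.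
Proof.
move=> uc; suff : cvg (u @ \oo) by move/cvg_ex.
apply: cauchy_cvg; apply/cauchyP => _ /pos_complexP[r r0 ->].
have [N uN] := uc _ (exprn_gt0 2 r0); exists (u N).
exists N => // n /= Nn; rewrite -ball_normE /= norm_lt_sqnorm//; exact: uN.
Qed.

End InnerProduct.

Lemma eq_norm_sqnorm (F : realType) (H K : hilbertType F) (x : H) (y : K) :
  `|x| = `|y| -> sqnorm x = sqnorm y.
Proof.
rewrite !norm_sqnorm => -[] /eqP.
by rewrite eqr_sqrt ?sqnorm_ge0// => /eqP.
Qed.

(** * Riesz representation of functionals dominated by a linear map *)

Section Riesz.
Variables (F : realType) (H : hilbertType F) (X : lmodType F[i]).
Variables (A : X -> H) (f : X -> F[i]) (M : F).
Hypotheses (A_linear : linear A) (f_linear : scalar f).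
Hypotheses (M_ge0 : 0 <= M) (f_le : forall x, sqmod (f x) <= M * sqnorm (A x)).

Let fD x y : f (x + y) = f x + f y.
Proof. by have := f_linear 1 x y; rewrite scale1r mul1r. Qed.

Let fZ a x : f (a *: x) = a * f x.
Proof.
have f0 : f 0 = 0.
  by have := f_linear (-1) 0 0; rewrite scaler0 addr0 mulN1r addNr.
by have := f_linear a x 0; rewrite f0 !addr0.
Qed.

(** If [f x = '[A x, z]], then [g x] is the squared distance from [A x] to [z], less the constant
    [sqnorm z]. *)
Let g x : F := sqnorm (A x) - 2 * complex.Re (f x).

Let g_ge x : - M <= g x.
Proof.
have := f_le x; rewrite sqmodE => fx.
have c : complex.Re (f x) ^+ 2 <= M * sqnorm (A x).
  by apply: le_trans fx; rewrite lerDl sqr_ge0.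
have := sqnorm_ge0 (A x); move: c M_ge0; rewrite /g.
set r := complex.Re _; set s := sqnorm _ => c M0 s0.
rewrite -subr_ge0 opprK; rewrite leNgt; apply/negP => h.
have h1 : M + s < 2 * r by lra.
have : (M + s) ^+ 2 < (2 * r) ^+ 2 by rewrite ltr_pXn2r// nnegrE; lra.
have := sqr_ge0 (M - s); nra.
Qed.

Let m := inf (range g).

Let m_le x : m <= g x.
Proof. by apply: ge_inf; [exists (- M) => _ [y _ <-]|exists x]. Qed.

Let g_comb x y (t : F) : g (x + t%:C *: y) = g x
  + 2 * t * (complex.Re '[A x, A y] - complex.Re (f y)) + t ^+ 2 * sqnorm (A y).
Proof.
rewrite /g (linear_funD A_linear) (linear_funZ A_linear) fD fZ.
rewrite sqnormD sqnormZ dotZr conj_realC.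
by rewrite ReD !ReCM sqmodE /= expr0n addr0; ring.
Qed.

(** The last argument of [g] is the midpoint of [x] and [y]; there [g] is at least its infimum, so
    near-minimisers have close images under [A]. *)
Let parallelogram x y :
  sqnorm (A x - A y) = 2 * g x + 2 * g y - 4 * g (x + (2^-1)%:C *: (y - x)).
Proof.
have fN : f (- x) = - f x by rewrite -scaleN1r fZ mulN1r.
rewrite g_comb /g (linear_funB A_linear) fD fN dotBr !ReD !ReN !sqnormB.
rewrite (dotp_conj (A x) (A y)) Re_conjc.
set a := complex.Re '[_, _]; rewrite -/(sqnorm (A x)).
by field.
Qed.

(* For A = id this is the Riesz representation theorem. The representing
   vector is the limit of A x_n along a minimising sequence x_n of
   |A x|^2 - 2 Re (f x), which is Cauchy by the parallelogram law. *)
Lemma riesz : exists2 z : H, sqnorm z <= M & forall x, f x = '[A x, z].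
Proof.
have [d [d_gt0 d_lt]] : exists d : nat -> F, (forall n, 0 < d n) /\
    forall e, 0 < e -> exists N : nat, forall n, (N <= n)%N -> d n < e.
  exists (fun n => n.+1%:R^-1); split=> [n|e e0]; first by rewrite invr_gt0.
  exists (Num.truncn e^-1) => n Nn.
  rewrite -[ltRHS]invrK ltf_pV2 ?posrE ?invr_gt0 ?ltr0n//.
  have /andP[_ h] := truncn_itv (ltW (etrans (invr_gt0 e) e0)).
  by apply: lt_le_trans h _; rewrite ler_nat.
have /choice[u uP] : forall n : nat, exists x, g x < m + d n.
  move=> n.
  have [||_ [x _ <-] ?] := @inf_adherent _ (range g) (d n); last by exists x.
  - exact: d_gt0.
  - by split; [exists (g 0), 0|exists (- M) => _ [y _ <-]].
have uE n k : sqnorm (A (u n) - A (u k)) <= 2 * d n + 2 * d k.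
  rewrite parallelogram; have := m_le (u n + (2^-1)%:C *: (u k - u n)).
  have := uP n; have := uP k; lra.
have [|z uz] := @cauchy_sqnorm _ _ (A \o u).
  move=> e e0; have [|N NP] := d_lt (e / 4); first by rewrite divr_gt0.
  exists N => n Nn /=; apply: le_lt_trans (uE _ _) _.
  have := NP N (leqnn _); have := NP n Nn; lra.
have {}uz (e : F) : 0 < e -> exists n, sqnorm (A (u n) - z) < e /\ d n < e.
  move=> e0; move/cvg_sqnormP: uz => /(_ _ e0)[N _ NP].
  have [N' N'P] := d_lt _ e0; exists (maxn N N'); split.
    by apply: NP; rewrite /= leq_maxl.
  by apply: N'P; rewrite leq_maxr.
(* Vanishing of the first variation in the direction [x]: its square is shown to be at most
   [4 * s * e] for every [e > 0]. *)
have ReE x : complex.Re (f x) = complex.Re '[A x, z].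
  apply/eqP; rewrite -subr_eq0; set c := _ - _.
  have s0 := sqnorm_ge0 (A x); set s := sqnorm (A x) in s0.
  suff c_le e : 0 < e -> c ^+ 2 <= 4 * s * e.
    rewrite -sqrf_eq0 eq_le sqr_ge0 andbT; apply/ler_addgt0Pr => e e0; rewrite add0r.
    apply: le_trans (c_le (e / (4 * s + 1)) _) _.
      by rewrite divr_gt0//; lra.
    rewrite mulrA ler_pdivrMr; last lra.
    nra.
  move=> e0; have [n [zn ne]] := uz _ e0.
  pose cn := complex.Re '[A (u n), A x] - complex.Re (f x).
  (* Discriminant bound: moving from [u n] along [x] lowers [g] by at most [d n], so the quadratic
     in [key] is nonnegative for all [t]. If [s = 0] it is affine, which forces [cn = 0]. *)
  have cn_le : cn ^+ 2 <= d n * s.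
    have key t : 0 <= d n + 2 * t * cn + t ^+ 2 * s.
      have := m_le (u n + t%:C *: x); rewrite g_comb -/cn -/s; have := uP n; lra.
    have [s00|sn0] := eqVneq s 0.
      rewrite s00 in key *; rewrite mulr0.
      have h := d_gt0 n.
      have [->|cn0] := eqVneq cn 0; first by rewrite expr0n.
      have := key (- d n / cn).
      rewrite mulr0 addr0 -mulrA divfK//; lra.
    have sp : 0 < s by rewrite lt_neqAle eq_sym sn0.
    have := key (- cn / s); rewrite -(pmulr_lge0 _ sp) => h.
    rewrite -subr_ge0; apply: le_trans h _; rewrite le_eqVlt; apply/orP; left.
    by apply/eqP; field.
  have d_le : complex.Re '[A (u n) - z, A x] ^+ 2 <= e * s.
    apply: le_trans (Re_dot_sqr_le _ _) _; apply: ler_wpM2r => //; exact: ltW.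
  have -> : c = complex.Re '[A (u n) - z, A x] - cn.
    rewrite /cn dotBl ReD ReN (dotp_conj (A x) z) Re_conjc /c; ring.
  have : cn ^+ 2 <= e * s.
    by apply: le_trans cn_le _; apply: ler_wpM2r => //; exact: ltW.
  move: d_le; set b := complex.Re _ => *.
  have := sqr_ge0 (b + cn); nra.
exists z.
  (* Completing the square, [g (u n) = sqnorm (A (u n) - z) - sqnorm z], and this is at least
     [- M]. *)
  apply/ler_addgt0Pr => e e0; have [n [zn _]] := uz _ e0.
  have := g_ge (u n); rewrite /g ReE; move: zn; rewrite sqnormB; lra.
(* Real parts agree; the same at ['i *: x] gives the imaginary parts. *)
move=> x; have fi := ReE ('i *: x); have fr := ReE x.
move: fi; rewrite fZ (linear_funZ A_linear) dotZl; move: fr.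
case: (f x) '[A x, z] => [a b] [a' b'] /= -> h; congr (_ +i* _); lra.
Qed.

End Riesz.

(** * Bounded operators, adjoints and isometries *)

Section BoundedOperators.
Variables (F : realType) (H K : hilbertType F).
Implicit Types T : H -> K.

Lemma bounded_sqnorm T : bounded_op T ->
  exists2 M : F, 0 <= M & forall x, sqnorm (T x) <= M * sqnorm x.
Proof.
move=> [_ [M TM]]; exists (M ^+ 2); first exact: sqr_ge0.
move=> x; have := TM x; rewrite !norm_sqnorm -rmorphM /= lecR => h.
rewrite -(sqr_sqrtr (sqnorm_ge0 (T x))) -(sqr_sqrtr (sqnorm_ge0 x)) -exprMn.
by rewrite ler_pXn2r ?nnegrE ?sqrtr_ge0//; apply: le_trans h; exact: sqrtr_ge0.
Qed.

Lemma sqnorm_bounded T (M : F) : linear T ->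
  (forall x, sqnorm (T x) <= M * sqnorm x) -> bounded_op T.
Proof.
move=> Tlin TM; split=> //; exists (Num.sqrt M) => x.
rewrite !norm_sqnorm -rmorphM /= lecR.
have [M0|M0] := leP 0 M; first by rewrite -sqrtrM// ler_wsqrtr.
have x0 : sqnorm x <= 0.
  have := le_trans (sqnorm_ge0 _) (TM x); have := sqnorm_ge0 x; nra.
rewrite (ler0_sqrtr (ltW M0)) mul0r ler0_sqrtr//.
by have := TM x; have := sqnorm_ge0 x; nra.
Qed.

End BoundedOperators.

Section Adjoints.
Variables (F : realType) (H K : hilbertType F).
Implicit Types T : H -> K.

(** For each [y], the Riesz theorem with [A] the identity represents [x |-> '[T x, y]]. *)
Lemma adjP T : bounded_op T -> forall x y, '[T x, y] = '[x, adj T y].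
Proof.
move=> Tb; have [M M0 TM] := bounded_sqnorm Tb.
suff /choice[T' T'P] : forall y, exists z, forall x, '[T x, y] = '[x, z].
  have TT' x y : '[T x, y] = '[x, T' y] by [].
  by rewrite (adjE TT').
move=> y.
have [||||z _ zP] := @riesz F H H id (fun x => '[T x, y]) (M * sqnorm y).
- by [].
- by move=> a u v; rewrite /= (proj1 Tb) dotp_linearl.
- by rewrite mulr_ge0// sqnorm_ge0.
- move=> x; apply: le_trans (sqmod_dot_le _ _) _.
  by rewrite mulrAC ler_wpM2r ?sqnorm_ge0.
by exists z.
Qed.

Lemma adjP' T : bounded_op T -> forall x y, '[y, T x] = '[adj T y, x].
Proof. by move=> Tb x y; rewrite dotp_conj adjP// -dotp_conj. Qed.

Lemma adjoint_linear T (T' : K -> H) :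
  (forall x y, '[T x, y] = '[x, T' y]) -> linear T'.
Proof.
move=> TT' a u v; apply: dotp_injr => x.
by rewrite -TT' !(dotDr, dotZr) !TT'.
Qed.

Lemma adj_linear T : bounded_op T -> linear (adj T).
Proof. by move=> Tb; apply: (adjoint_linear (adjP Tb)). Qed.

(** With [w = adj T y], Cauchy-Schwarz applied to ['[T w, y] = '[w, w]] gives the bound multiplied
    by [sqnorm w]. *)
Lemma sqnorm_adj_le T (M : F) : bounded_op T ->
  (forall x, sqnorm (T x) <= M * sqnorm x) -> 0 <= M ->
  forall y, sqnorm (adj T y) <= M * sqnorm y.
Proof.
move=> Tb TM M0 y; set w := adj T y.
have [->|w0] := eqVneq (sqnorm w) 0; first by rewrite mulr_ge0// sqnorm_ge0.
have wp : 0 < sqnorm w by rewrite lt_neqAle eq_sym w0 sqnorm_ge0.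
rewrite -(ler_pM2l wp); have := sqmod_dot_le (T w) y.
rewrite adjP// dotpp sqmodE /= expr0n addr0 expr2 => /le_trans; apply.
rewrite [leRHS]mulrCA mulrA; apply: ler_wpM2r; [exact: sqnorm_ge0|exact: TM].
Qed.

Lemma adj_bounded T : bounded_op T -> bounded_op (adj T).
Proof.
move=> Tb; have [M M0 TM] := bounded_sqnorm Tb.
apply: (sqnorm_bounded (M := M)); first exact: adj_linear.
exact: sqnorm_adj_le.
Qed.

Lemma isometry_sqnorm T : linear_isometry T -> forall x, sqnorm (T x) = sqnorm x.
Proof.
by move=> [_ Ti] x; apply: eq_norm_sqnorm.
Qed.

Lemma sqnorm_isometry T : linear T -> (forall x, sqnorm (T x) = sqnorm x) ->
  linear_isometry T.
Proof. by move=> Tl Ti; split=> // x; rewrite !norm_sqnorm Ti. Qed.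

Lemma isometry_bounded T : linear_isometry T -> bounded_op T.
Proof.
move=> Ti; apply: (sqnorm_bounded (M := 1)); first exact: (proj1 Ti).
by move=> x; rewrite mul1r isometry_sqnorm.
Qed.

(** Polarisation: the squared norm of [u + y] yields real parts, and ['i *: x] the imaginary
    ones. *)
Lemma isometry_dot T : linear_isometry T -> forall x y, '[T x, T y] = '[x, y].
Proof.
move=> Ti x y; have [Tl _] := Ti.
have ReE u : complex.Re '[T u, T y] = complex.Re '[u, y].
  have := isometry_sqnorm Ti (u + y); rewrite (linear_funD Tl) !sqnormD.
  by rewrite !(isometry_sqnorm Ti); lra.
have := ReE ('i *: x); have := ReE x; rewrite (linear_funZ Tl) !dotZl.
case: '[T x, T y] '[x, y] => [a b] [a' b'] /= -> h; congr (_ +i* _); lra.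
Qed.

Lemma isometry_adjK T : linear_isometry T -> cancel T (adj T).
Proof.
move=> Ti x; apply: dotp_injr => z.
by rewrite -(adjP (isometry_bounded Ti)) isometry_dot.
Qed.

End Adjoints.

Lemma adj_adj (F : realType) (H K : hilbertType F) (T : H -> K) :
  bounded_op T -> adj (adj T) = T.
Proof. by move=> Tb; apply: adjE => x y; rewrite -adjP'. Qed.

(** * Conjugations *)

Section Conjugation.
Variables (F : realType) (H : hilbertType F) (J : H -> H).
Hypothesis J_conj : conjugation J.

Lemma conjugationK : involutive J.
Proof. by case: J_conj => _ _ JJ x; rewrite -[LHS]/((J \o J) x) JJ. Qed.

Lemma conjugationD x y : J (x + y) = J x + J y.
Proof.
by case: J_conj => Jl _ _; have := Jl 1 x y; rewrite scale1r rmorph1 scale1r.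
Qed.

Lemma conjugation0 : J 0 = 0.
Proof. by apply: (addIr (J 0)); rewrite -conjugationD !add0r. Qed.

Lemma conjugationZ a x : J (a *: x) = conjc a *: J x.
Proof.
by case: J_conj => Jl _ _; have := Jl a x 0; rewrite conjugation0 !addr0.
Qed.

Lemma sqnorm_conjugation x : sqnorm (J x) = sqnorm x.
Proof.
by case: J_conj => _ Jn _; apply: eq_norm_sqnorm.
Qed.

(** Polarisation again, but antilinearity flips the sign of the imaginary part, so ['[J x, J z] =
    '[z, x]]; here [z = J y]. *)
Lemma conjugation_dot x y : '[J x, y] = '[J y, x].
Proof.
rewrite -{1}(conjugationK y); set z := J y; rewrite (dotp_conj x z).
have ReE u : complex.Re '[J u, J z] = complex.Re '[u, z].
  have := sqnorm_conjugation (u + z); rewrite conjugationD !sqnormD.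
  by rewrite !sqnorm_conjugation; lra.
have := ReE ('i *: x); have := ReE x; rewrite conjugationZ !dotZl.
case: '[J x, J z] '[x, z] => [a b] [a' b'] /= -> h; congr (_ +i* _); lra.
Qed.

End Conjugation.

(** * Coordinates, shifts and conjugation on [l2] *)

Section L2Facts.
Variable F : realType.
Implicit Types u v : l2 F.

Lemma sqnorm_l2E u : sqnorm u = l2_sqnorm u.
Proof.
have := norm_sqnorm u; rewrite -[`|u|]/(l2_norm u) => -[] /eqP.
by rewrite eqr_sqrt ?sqnorm_ge0 ?l2_sqnorm_ge0// eq_sym => /eqP.
Qed.

Lemma l2_conj_conjugation : conjugation (@l2_conj F).
Proof.
split=> [a u v|u|].
- apply: l2_ext => k; rewrite l2_valP -[LHS]/(conjc (a * u k + v k)).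
  by rewrite rmorphD rmorphM.
- rewrite !norm_sqnorm !sqnorm_l2E; congr (Num.sqrt (lim (series _ @ \oo)))%:C.
  by apply/funext => k /=; rewrite sqmod_conj.
- by apply/funext => u; apply: l2_ext => k /=; rewrite /conj_fun conjcK.
Qed.

Lemma bshift_fshift u : bshift (fshift u) = u.
Proof. exact: l2_ext. Qed.

Lemma bshift_conj u : bshift (l2_conj u) = l2_conj (bshift u).
Proof. exact: l2_ext. Qed.

Lemma fshift_basis j : fshift (l2_basis F j) = l2_basis F j.+1.
Proof. by apply: l2_ext => -[|k]. Qed.

(** Adjointness of the two shifts lowers [j]; at [j = 0] only the first term of the series
    survives. *)
Lemma dot_basis u j : '[u, l2_basis F j] = u j.
Proof.
elim: j u => [|j IH] u; last first.
  by rewrite -fshift_basis dotp_conj bshift_adjoint -dotp_conj IH.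
have lim0 (g : F[i] -> F) : g 0 = 0 ->
    limn (series (fun k => g (u k * Num.conj (l2_basis F 0 k)))) = g (u 0).
  move=> g0; apply/cvg_lim => //; rewrite -cvg_shiftS.
  rewrite (_ : (fun _ => _) = cst (g (u 0))); first exact: cvg_cst.
  apply/funext => n /=; rewrite /series /= big_nat_recl//= /basis_fun /=.
  rewrite rmorph1 mulr1 big1 ?addr0// => k _.
  by rewrite rmorph0 mulr0.
rewrite -[LHS]/(l2_dot _ _) /l2_dot !lim0//.
by case: (u 0).
Qed.

Lemma sqnorm_basis j : sqnorm (l2_basis F j) = 1.
Proof. by rewrite /sqnorm dot_basis /= /basis_fun eqxx. Qed.

Lemma iter_bshift n u k : iter n (@bshift F) u k = u (n + k)%N.
Proof. by elim: n u k => // n IH u k; rewrite iterSr IH /= /bshift_fun addSn. Qed.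

End L2Facts.

(* The observability operator of the pair (T, v), whose defect identity makes
   the partial sums telescope. *)
Lemma observability_isometry (F : realType) (H : hilbertType F) (T : H -> H)
    (v : H) : linear T ->
  (forall x, sqnorm x = sqmod '[x, v] + sqnorm (T x)) ->
  asymptotically_stable T ->
  exists V : H -> l2 F,
    linear_isometry V /\ forall h k, V h k = '[iter k T h, v].
Proof.
move=> T_linear T_defect T_stable.
have sumE h n : series (fun k => sqmod '[iter k T h, v]) n =
    sqnorm h - sqnorm (iter n T h).
  elim: n => [|n IH]; first by rewrite /series /= big_geq// subrr.
  move: IH; rewrite /series /= big_nat_recr//= => ->.
  by rewrite (T_defect (iter n T h)); ring.
have inl2 h : (fun k => '[iter k T h, v]) \in @l2_pred F.
  apply/l2_predP; apply: (@square_summable_bounded _ _ (sqnorm h)) => n.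
  by rewrite sumE lerBlDr lerDl sqnorm_ge0.
have iter_linear n : linear (iter n T).
  elim: n => [|n IH]; first by move=> a x y.
  by move=> a x y; rewrite !iterS IH T_linear.
exists (fun h => L2 (inl2 h)); split=> //; apply: sqnorm_isometry => [a x y|h].
  by apply: l2_ext => k; rewrite l2_valP /= iter_linear dotp_linearl.
rewrite sqnorm_l2E; apply/cvg_lim => //=.
apply/cvgrPdist_lt => e e0.
have /cvg_sqnormP/(_ _ e0) := T_stable h; apply: filterS => n; rewrite subr0 => hn.
by rewrite sumE opprB addrC subrK ger0_norm ?sqnorm_ge0.
Qed.

(** * Operators of a spectral data tuple *)

Section SpectralData.
Variables (F : realType) (H : hilbertType F).
Variables (R R1 : H -> H) (p : H) (J phi phi1 : H -> H).
Hypothesis sd : spectral_data R R1 p J phi phi1.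

Let D := ext_R1Rinv R R1.
Let T := Sigma_star R R1 phi phi1.
Let q := inv_op R p.
Let v := phi q.

Lemma R_bounded : bounded_op R. Proof. by case: (sd_R sd) => -[]. Qed.
Lemma R1_bounded : bounded_op R1. Proof. by case: (sd_R1 sd) => -[]. Qed.
Lemma phi_bounded : bounded_op phi. Proof. by case: (sd_phi sd) => -[]. Qed.
Lemma phi1_bounded : bounded_op phi1. Proof. by case: (sd_phi1 sd) => -[]. Qed.

Lemma R_sym x y : '[R x, y] = '[x, R y].
Proof. by rewrite (adjP R_bounded); case: (sd_R sd) => -[_ ->]. Qed.

Lemma R1_sym x y : '[R1 x, y] = '[x, R1 y].
Proof. by rewrite (adjP R1_bounded); case: (sd_R1 sd) => -[_ ->]. Qed.

Lemma R_eq0 x : R x = 0 -> x = 0.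
Proof. by move=> Rx; have : op_ker R x by []; rewrite (sd_kerR sd). Qed.

Lemma R_inj : injective R.
Proof.
move=> x y Rxy; apply/eqP; rewrite -subr_eq0; apply/eqP/R_eq0.
by rewrite (linear_funB (proj1 R_bounded)) Rxy subrr.
Qed.

(** The orthogonal complement of the range of the self-adjoint [R] is its kernel, which is
    trivial. *)
Lemma R_dense z : (forall x, '[R x, z] = 0) -> z = 0.
Proof.
by move=> h; apply: R_eq0; apply: dotp_injr => x; rewrite -R_sym h dot0r.
Qed.

Lemma R_dense_eq y z : (forall x, '[R x, y] = '[R x, z]) -> y = z.
Proof.
move=> h; apply/eqP; rewrite -subr_eq0; apply/eqP/R_dense => x.
by rewrite dotBr h subrr.
Qed.

Lemma RR_rank_one x : R (R x) = R1 (R1 x) + '[x, p] *: p.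
Proof.
have := congr1 (@^~ x) (sd_rank_one sd); rewrite /rank_one /= => <-.
by rewrite addrC subrK.
Qed.

Lemma dot_RR x y : '[R x, R y] = '[R1 x, R1 y] + '[x, p] * '[p, y].
Proof. by rewrite -R_sym RR_rank_one dotDl R1_sym dotZl. Qed.

(** Source of two dominations by [R x]: that of ['[x, p]] yields [q], that of [R1 x] yields [D]. *)
Lemma sqnorm_R x : sqnorm (R x) = sqnorm (R1 x) + sqmod '[x, p].
Proof.
apply: (@complexI F); rewrite rmorphD /= -!dotpp dot_RR.
by rewrite (dotp_conj x p) sqmod_conjE.
Qed.

(** * The vector [q] and the contraction [D] *)

Lemma inv_opK x : inv_op R (R x) = x.
Proof. by rewrite /inv_op; case: xgetP => [y _ /R_inj|/(_ x)[]]. Qed.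

(* p is in the range of R because x |-> <x, p> is bounded by |R x|. *)
Lemma R_inv_p : R q = p /\ sqnorm q <= 1.
Proof.
have [|||z z1 zP] := @riesz F H H R (fun x => '[x, p]) 1 (proj1 R_bounded).
- by move=> a x y; rewrite /= dotp_linearl.
- exact: ler01.
- by move=> x; rewrite mul1r sqnorm_R lerDr sqnorm_ge0.
suff Rz : R z = p by rewrite /q -Rz inv_opK.
by apply: dotp_injr => x; rewrite zP R_sym.
Qed.

(** The adjoint [E] is built first: [x |-> '[R1 x, y]] is dominated by [R x], so Riesz relative to
    [R] represents it as ['[R x, E y]]. Density of the range makes [E] linear. *)
Lemma ext_R1Rinv_exists : exists C : H -> H,
  [/\ linear C, forall x, sqnorm (C x) <= sqnorm x & forall x, C (R x) = R1 x].
Proof.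
have /choice[E EP] : forall y, exists z, sqnorm z <= sqnorm y /\
    forall x, '[R1 x, y] = '[R x, z].
  move=> y.
  have [|||z z1 zP] :=
    @riesz F H H R (fun x => '[R1 x, y]) (sqnorm y) (proj1 R_bounded).
  - by move=> a u w; rewrite /= (proj1 R1_bounded) dotp_linearl.
  - exact: sqnorm_ge0.
  - move=> x; rewrite mulrC; apply: le_trans (sqmod_dot_le _ _) _.
    by rewrite ler_wpM2r ?sqnorm_ge0// sqnorm_R lerDl sqmod_ge0.
  by exists z.
have E_linear : linear E.
  move=> a x y; apply: R_dense_eq => z.
  by rewrite -(proj2 (EP _)) !(dotDr, dotZr) !(proj2 (EP _)).
have E_bounded : bounded_op E.
  by apply: (sqnorm_bounded (M := 1)) => // x; rewrite mul1r; case: (EP x).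
exists (adj E); split=> [|x|x].
- exact: adj_linear.
- rewrite -[leRHS]mul1r; apply: sqnorm_adj_le => // y.
  by rewrite mul1r; case: (EP y).
- apply: dotp_injr => y.
  by rewrite -(adjP E_bounded) dotp_conj -(proj2 (EP y)) -dotp_conj.
Qed.

Lemma ext_R1RinvP :
  [/\ linear D, forall x, sqnorm (D x) <= sqnorm x & forall x, D (R x) = R1 x].
Proof.
have [C [C_linear C_le CR]] := ext_R1Rinv_exists.
rewrite /D /ext_R1Rinv; case: xgetP => [C' _ [/= C'l C'n C'R]|/(_ C)[]].
  split=> // x; last by rewrite C'R ?inv_opK//; exists x.
  have := C'n x; rewrite !norm_sqnorm lecR.
  rewrite -[X in _ -> _ <= X]sqr_sqrtr ?sqnorm_ge0//.
  rewrite -[X in _ -> X <= _]sqr_sqrtr ?sqnorm_ge0//.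
  by rewrite ler_pXn2r// nnegrE sqrtr_ge0.
split=> // x; first by rewrite !norm_sqnorm lecR ler_wsqrtr.
by case=> y _ <-; rewrite inv_opK CR.
Qed.

Lemma ext_R1Rinv_bounded : bounded_op D.
Proof.
have [Dl Dn _] := ext_R1RinvP; apply: (sqnorm_bounded (M := 1)) => // x.
by rewrite mul1r.
Qed.

Lemma ext_R1Rinv_R x : D (R x) = R1 x. Proof. by case: ext_R1RinvP. Qed.

(** On the range of [R] this is the rank-one identity seen through [D (R x) = R1 x] and [R q = p].
    Self-adjointness of both sides and density extend it to all [x]. *)
Lemma adj_ext_R1RinvK x : adj D (D x) = x - '[x, q] *: q.
Proof.
have [Rq _] := R_inv_p.
have DDR y : adj D (D (R y)) = R y - '[R y, q] *: q.
  apply: R_dense_eq => z; rewrite -(adjP ext_R1Rinv_bounded) !ext_R1Rinv_R.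
  rewrite dotBr dotZr dot_RR.
  rewrite -dotp_conj -(R_sym q) (R_sym z) Rq.
  by rewrite [X in _ + _ - X]mulrC addrK.
apply: R_dense_eq => z.
rewrite -(adjP ext_R1Rinv_bounded) (adjP' ext_R1Rinv_bounded) DDR.
rewrite dotBl dotBr dotZl dotZr.
by rewrite -dotp_conj mulrC.
Qed.

Lemma adj_ext_R1Rinv_ker y : R1 y = 0 -> adj D y = 0.
Proof.
move=> R1y; apply: R_dense => z.
by rewrite -(adjP ext_R1Rinv_bounded) ext_R1Rinv_R R1_sym R1y dot0r.
Qed.

(** * The unitary [phi], the partial isometry [phi1] and the defect identity *)

Lemma phiK : cancel phi (adj phi).
Proof.
by case: (sd_phi sd) => -[_ e _] _ x; rewrite -[LHS]/((adj phi \o phi) x) e.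
Qed.

Lemma adj_phiK : cancel (adj phi) phi.
Proof.
by case: (sd_phi sd) => -[_ _ e] _ x; rewrite -[LHS]/((phi \o adj phi) x) e.
Qed.

Lemma adj_phiE x : adj phi x = J (phi (J x)).
Proof. by case: (sd_phi sd) => _ ->. Qed.

Lemma adj_phi1E x : adj phi1 x = J (phi1 (J x)).
Proof. by case: (sd_phi1 sd) => _ ->. Qed.

Lemma J_conj : conjugation J. Proof. exact: (sd_J sd). Qed.
Let JK := conjugationK J_conj.

Lemma J_R x : J (R x) = R (J x).
Proof. by have := congr1 (@^~ x) (sd_JR sd). Qed.

Lemma J_R1 x : J (R1 x) = R1 (J x).
Proof. by have := congr1 (@^~ x) (sd_JR1 sd). Qed.

Lemma phi_R x : phi (R x) = R (phi x).
Proof. by have := congr1 (@^~ x) (sd_phiR sd). Qed.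

Lemma phi1_R1 x : phi1 (R1 x) = R1 (phi1 x).
Proof. by have := congr1 (@^~ x) (sd_phi1R1 sd). Qed.

Lemma sqnorm_phi x : sqnorm (phi x) = sqnorm x.
Proof. by rewrite {1}/sqnorm (adjP phi_bounded) phiK. Qed.

Lemma phi1_eq0 x : phi1 x = 0 <-> R1 x = 0.
Proof. by have := congr1 (@^~ x) (sd_kerphi1 sd); rewrite /op_ker /= => ->. Qed.

(** [D x] is orthogonal to the kernel of [R1], which is that of [phi1], hence lies in the initial
    space of [phi1]. *)
Lemma sqnorm_phi1_ext_R1Rinv x : sqnorm (phi1 (D x)) = sqnorm (D x).
Proof.
have [[_ phi1_iso] _] := sd_phi1 sd.
apply: eq_norm_sqnorm; apply: phi1_iso => y /phi1_eq0 R1y.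
by rewrite (adjP ext_R1Rinv_bounded) adj_ext_R1Rinv_ker// dot0r.
Qed.

Lemma Sigma_star_linear : linear T.
Proof.
rewrite /T /Sigma_star; apply: linear_comp (adj_linear phi_bounded).
exact: linear_comp (proj1 phi1_bounded) (proj1 ext_R1Rinv_bounded).
Qed.

Lemma Sigma_star_defect x : sqnorm x = sqmod '[x, v] + sqnorm (T x).
Proof.
rewrite -[T x]/(phi1 (D (adj phi x))) sqnorm_phi1_ext_R1Rinv.
apply: (@complexI F); rewrite rmorphD /= -!dotpp.
rewrite (adjP ext_R1Rinv_bounded) adj_ext_R1RinvK.
rewrite dotBr dotZr -(adjP' phi_bounded) -/v -dotp_conj.
rewrite -(adjP phi_bounded) adj_phiK -(adjP' phi_bounded) -/v.
rewrite -sqmod_conjE -dotp_conj.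
by rewrite ['[v, x] * _]mulrC addrC subrK.
Qed.

(** * The antilinear symmetric operators [A] and [A1] *)

Let A x := R (phi (J x)).
Let A1 x := R1 (phi1 (J x)).

(** [adj phi] equals [J \o phi \o J], and both [J] and [phi] commute with [R]. *)
Lemma R_phi_J_sym x y : '[A x, y] = '[A y, x].
Proof.
rewrite /A R_sym (adjP phi_bounded) (conjugation_dot J_conj) adj_phiE JK.
by rewrite J_R phi_R.
Qed.

Lemma R1_phi1_J_sym x y : '[A1 x, y] = '[A1 y, x].
Proof.
rewrite /A1 R1_sym (adjP phi1_bounded) (conjugation_dot J_conj) adj_phi1E JK.
by rewrite J_R1 phi1_R1.
Qed.

Lemma Sigma_star_R_phi_J x : T (A x) = A1 x.
Proof.
rewrite -[T _]/(phi1 (D (adj phi _))) /A -phi_R phiK ext_R1Rinv_R.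
by rewrite phi1_R1.
Qed.

Lemma R_phi_J_defect : A v = p.
Proof.
have [Rq _] := R_inv_p.
(* [phi \o J \o phi = J], because [adj phi = J \o phi \o J] inverts [phi]. *)
rewrite /A /v -[phi (J _)]JK -adj_phiE phiK -/q.
rewrite -J_R Rq; exact: (sd_Jp sd).
Qed.

Lemma R_phi_J_inj : injective A.
Proof.
move=> x y /R_inj h; have := congr1 (adj phi) h; rewrite !phiK => {}h.
by rewrite -(JK x) h JK.
Qed.

Lemma R_phi_J_dense_eq y z : (forall x, '[A x, y] = '[A x, z]) -> y = z.
Proof.
move=> h; apply: R_dense_eq => x.
rewrite -(adj_phiK x) -(JK (adj phi x)); exact: (h (J (adj phi x))).
Qed.
Lemma Sigma_star_bounded : bounded_op T.
Proof.
apply: (sqnorm_bounded (M := 1)) Sigma_star_linear _ => x.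
by rewrite mul1r (Sigma_star_defect x) lerDr sqmod_ge0.
Qed.

(** Transpose of [T (A x) = A1 x] under the symmetry of [A] and [A1]. *)
Lemma R_phi_J_adj_Sigma_star x : A (adj T x) = A1 x.
Proof.
apply: dotp_injl => z.
by rewrite R_phi_J_sym -(adjP Sigma_star_bounded) Sigma_star_R_phi_J R1_phi1_J_sym.
Qed.

Lemma R_phi_J_antilinear a x y : A (a *: x + y) = conjc a *: A x + A y.
Proof.
rewrite /A (conjugationD J_conj) (conjugationZ J_conj).
by rewrite (proj1 phi_bounded) (proj1 R_bounded).
Qed.

(** The form that the first required identity forces on the Hankel operator, given [V]; the
    antilinear factors [l2_conj] and [A] compose to a linear map. *)
Let model (V : H -> l2 F) u := l2_conj (V (A (adj V u))).

Let C_conj := l2_conj_conjugation F.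

(** * Isometries intertwining [T] with the backward shift *)

Section Intertwining.
Variable V : H -> l2 F.
Hypothesis V_iso : linear_isometry V.

Let V_bounded := isometry_bounded V_iso.
Let VK := isometry_adjK V_iso.

Lemma model_adj x y : '[model V x, y] = '[x, V (A (adj V (l2_conj y)))].
Proof.
rewrite (conjugation_dot C_conj) (adjP' V_bounded) (adjP' V_bounded).
by rewrite dotp_conj R_phi_J_sym -dotp_conj.
Qed.

Lemma model_bounded : bounded_op (model V).
Proof.
have [M M0 RM] := bounded_sqnorm R_bounded.
have [N N0 VN] := bounded_sqnorm (adj_bounded V_bounded).
apply: (sqnorm_bounded (M := M * N)) => [a x y|u].
  rewrite /model (adj_linear V_bounded) R_phi_J_antilinear (proj1 V_iso).
  by rewrite (conjugationD C_conj) (conjugationZ C_conj) conjcK.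
rewrite (sqnorm_conjugation C_conj) (isometry_sqnorm V_iso).
apply: le_trans (RM _) _; rewrite sqnorm_phi (sqnorm_conjugation J_conj) -mulrA.
exact: ler_wpM2l.
Qed.

(** The first basis vector is real, so the conjugation in [model_adj] fixes it. *)
Lemma adj_model_basis0 :
  adj (model V) (l2_basis F 0) = V (A (adj V (l2_basis F 0))).
Proof.
rewrite (adjE model_adj); congr (V (A (adj V _))).
apply: l2_ext => k /=; rewrite /conj_fun /= /basis_fun.
by case: (k == 0%N); rewrite ?conjc1 ?conjc0.
Qed.

Lemma isometry_coord0 h : V h 0 = '[h, adj V (l2_basis F 0)].
Proof. by rewrite -(adjP V_bounded) dot_basis. Qed.

Lemma observability_unique :
  hankel (model V) ->
  @l2_conj F \o (model V \o @fshift F) = V \o R1 \o phi1 \o J \o adj V ->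
  adj (model V) (l2_basis F 0) = V p ->
  forall h k, V h k = '[iter k T h, v].
Proof.
move=> [_ hk] e2; rewrite adj_model_basis0 => /(can_inj VK) Av.
have {Av} v0 : adj V (l2_basis F 0) = v.
  by apply: R_phi_J_inj; rewrite Av R_phi_J_defect.
have VTA x : bshift (V (A x)) = V (T (A x)).
  have /= := congr1 (@^~ (V x)) e2; rewrite VK Sigma_star_R_phi_J => <-.
  have /= -> := congr1 (@^~ (V x)) hk.
  by rewrite -bshift_conj /model VK (conjugationK C_conj).
(* Extension from the range of [A] to all [h]: the equivalent identity between adjoints is tested on
   that dense range. *)
have VT h : bshift (V h) = V (T h).
  apply: dotp_injl => w; rewrite dotp_conj -bshift_adjoint -dotp_conj.
  rewrite (adjP V_bounded) (adjP V_bounded) (adjP Sigma_star_bounded); congr '[h, _].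
  apply: R_phi_J_dense_eq => x; rewrite -(adjP V_bounded) -(adjP Sigma_star_bounded).
  rewrite -(adjP V_bounded) -VTA.
  by rewrite dotp_conj bshift_adjoint -dotp_conj.
move=> h k; rewrite -[k]addn0 -iter_bshift.
have -> : iter k (@bshift F) (V h) = V (iter k T h).
  by elim: k => //= k ->; rewrite VT.
by rewrite isometry_coord0 v0 addn0.
Qed.

Hypothesis V_obs : forall h k, V h k = '[iter k T h, v].

Lemma adj_observability_basis0 : adj V (l2_basis F 0) = v.
Proof. by apply: dotp_injr => h; rewrite -isometry_coord0 V_obs. Qed.

Lemma bshift_observability h : bshift (V h) = V (T h).
Proof.
by apply: l2_ext => k; rewrite -[LHS]/(V h k.+1) !V_obs iterSr.
Qed.

Lemma adj_observability_fshift u : adj V (fshift u) = adj T (adj V u).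
Proof.
apply: dotp_injr => h; rewrite -(adjP V_bounded) -(adjP Sigma_star_bounded).
rewrite -(adjP V_bounded) -bshift_observability dotp_conj bshift_adjoint.
by rewrite -dotp_conj.
Qed.

Lemma model_fshift u : model V (fshift u) = l2_conj (V (A1 (adj V u))).
Proof. by rewrite /model adj_observability_fshift R_phi_J_adj_Sigma_star. Qed.

Lemma model_hankel : hankel (model V).
Proof.
split; first exact: model_bounded.
apply/funext => u /=; rewrite model_fshift -Sigma_star_R_phi_J -bshift_observability.
by rewrite -bshift_conj.
Qed.

(** * The kernel criterion *)

Lemma model_ker0 :
  op_ker (model V) = [set 0] <-> forall u, adj V u = 0 -> u = 0.
Proof.
have V0 : adj V 0 = 0 := linear_fun0 (adj_linear V_bounded).
have A0 : A 0 = 0.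
  rewrite /A (conjugation0 J_conj) (linear_fun0 (proj1 phi_bounded)).
  exact: linear_fun0 (proj1 R_bounded).
have Gam0 u : adj V u = 0 -> model V u = 0.
  by move=> u0; rewrite /model u0 A0 (linear_fun0 (proj1 V_iso)) (conjugation0 C_conj).
split=> [kerG u u0|kerV].
  by have : op_ker (model V) u by [exact: Gam0]; rewrite kerG.
apply/seteqP; split=> [u|_ ->]; last exact: Gam0.
(* [l2_conj], [V] and [A] are injective, so only [adj V] contributes to the kernel. *)
rewrite /op_ker /= /model -{1}(conjugation0 C_conj).
move=> /(can_inj (conjugationK C_conj)) VA0; apply: kerV.
by apply: R_phi_J_inj; apply: (can_inj VK); rewrite VA0 A0 (linear_fun0 (proj1 V_iso)).
Qed.

Lemma observability_onto_norm : (forall u, adj V u = 0 -> u = 0) ->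
  sqnorm q = 1 /\ ~ range R q.
Proof.
move=> kerV; have [Rq _] := R_inv_p.
have VVK u : V (adj V u) = u.
  apply/eqP; rewrite -subr_eq0; apply/eqP/kerV.
  by rewrite (linear_funB (adj_linear V_bounded)) VK subrr.
have q1 : sqnorm q = 1.
  rewrite -sqnorm_phi -/v -adj_observability_basis0 -(isometry_sqnorm V_iso) VVK.
  exact: sqnorm_basis.
split=> // -[w _ Rw].
have R1w : R1 w = 0.
  apply: sqnorm_eq0; rewrite /sqnorm R1_sym.
  suff -> : R1 (R1 w) = 0 by rewrite dot0r.
  (* ['[w, p] = '[R w, q] = 1], so the rank-one identity at [w] reads [p = R1 (R1 w) + p]. *)
  have := RR_rank_one w; rewrite Rw Rq -{2}Rq -R_sym Rw dotpp q1 scale1r => h.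
  by apply/eqP; rewrite -(inj_eq (addIr p)) add0r -h.
(* As [V] is onto, pulling [fshift] back through [V] gives preimages under [T]. *)
have JwT : J w = T (adj V (fshift (V (J w)))).
  by apply: (can_inj VK); rewrite -bshift_observability VVK bshift_fshift.
(* [J w] lies in the range of [phi1], while [adj phi1 (J w) = J (phi1 w) = 0]. *)
have Jw0 : J w = 0.
  apply: sqnorm_eq0; rewrite /sqnorm {1}JwT.
  rewrite -[T _]/(phi1 (D (adj phi _))) (adjP phi1_bounded) adj_phi1E JK.
  by rewrite (phi1_eq0 w).2// (conjugation0 J_conj) dot0r.
have w0 : w = 0 by rewrite -(JK w) Jw0 (conjugation0 J_conj).
move/eqP: q1; rewrite -Rw w0 (linear_fun0 (proj1 R_bounded)) sqnorm0.
by rewrite eq_sym oner_eq0.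
Qed.

Lemma norm_observability_onto : sqnorm q = 1 -> ~ range R q ->
  forall u, adj V u = 0 -> u = 0.
Proof.
move=> q1 qR; have [Rq _] := R_inv_p.
have qq1 : '[q, q] = 1 by rewrite dotpp q1.
(* [R1 x = 0] gives [R x = '[x, p] *: q]; a nonzero coefficient would put [q] in the range of
   [R]. *)
have R1_eq0 x : R1 x = 0 -> x = 0.
  move=> R1x; have : R (R x) = R ('[x, p] *: q).
    by rewrite RR_rank_one R1x (linear_fun0 (proj1 R1_bounded)) add0r
      (linear_funZ (proj1 R_bounded)) Rq.
  move/R_inj => Rx; have [xp|xp] := eqVneq '[x, p] 0.
    by apply: R_eq0; rewrite Rx xp scale0r.
  case: qR; exists ('[x, p]^-1 *: x) => //.
  by rewrite (linear_funZ (proj1 R_bounded)) Rx scalerA mulVf// scale1r.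
have phi1_surj x : phi1 (adj phi1 x) = x.
  rewrite -{1}(adj_adj phi1_bounded); apply: isometry_adjK.
  apply: sqnorm_isometry; first exact: adj_linear phi1_bounded.
  move=> y; rewrite adj_phi1E (sqnorm_conjugation J_conj).
  have [[_ phi1_iso] _] := sd_phi1 sd.
  rewrite -[RHS](sqnorm_conjugation J_conj); apply: eq_norm_sqnorm.
  apply: phi1_iso => z /phi1_eq0/R1_eq0 ->; exact: dot0r.
have Dq : D q = 0.
  apply: sqnorm_eq0; rewrite /sqnorm (adjP ext_R1Rinv_bounded) adj_ext_R1RinvK.
  by rewrite qq1 scale1r subrr dot0r.
(* The range of [R1] is dense, [R1 z = D (R z)], and [D \o adj D \o D = D] since [D q = 0]. *)
have D_surj y : D (adj D y) = y.
  apply/eqP; rewrite -subr_eq0; apply/eqP/R1_eq0; apply: dotp_injr => z.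
  rewrite dot0r -R1_sym dotBr (adjP' ext_R1Rinv_bounded) -(adjP ext_R1Rinv_bounded).
  rewrite -ext_R1Rinv_R adj_ext_R1RinvK (linear_funB (proj1 ext_R1Rinv_bounded)).
  by rewrite (linear_funZ (proj1 ext_R1Rinv_bounded)) Dq scaler0 subr0 subrr.
have Tv : T v = 0.
  rewrite -[T _]/(phi1 (D (adj phi _))) phiK Dq.
  exact: linear_fun0 (proj1 phi1_bounded).
have T_surj y : T (phi (adj D (adj phi1 y))) = y.
  by rewrite -[T _]/(phi1 (D (adj phi _))) phiK D_surj phi1_surj.
have vv1 : '[v, v] = 1 by rewrite dotpp sqnorm_phi q1.
(* Induction on [n], starting from [v]: its image is the first basis vector because [T v = 0] and
   ['[v, v] = 1]. *)
have basis_range n : exists h, V h = l2_basis F n.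
  elim: n => [|n [h Vh]].
    exists v; apply: l2_ext => -[|k]; first by rewrite V_obs.
    rewrite V_obs iterSr Tv [iter _ _ _](_ : _ = 0) ?dot0l//.
    by elim: k => //= k ->; exact: linear_fun0 Sigma_star_linear.
  (* [T x = h]; subtracting a multiple of [v], which [T] kills, clears coordinate 0 and leaves the
     later ones intact. *)
  pose x := phi (adj D (adj phi1 h)).
  exists (x - '[x, v] *: v); apply: l2_ext => -[|k].
    by rewrite V_obs /= dotBl dotZl vv1 mulr1 subrr.
  rewrite -[LHS]/(bshift (V _) k) bshift_observability (linear_funB Sigma_star_linear).
  by rewrite (linear_funZ Sigma_star_linear) Tv scaler0 subr0 T_surj Vh.
move=> u u0; apply: l2_ext => k; have [h Vh] := basis_range k.
by rewrite -dot_basis -Vh (adjP' V_bounded) u0 dot0l.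
Qed.

End Intertwining.

(** * Existence, uniqueness and injectivity of the Hankel operator *)

Lemma spectral_data_hankel : asymptotically_stable T ->
  exists Gamma : l2 F -> l2 F,
    unique (fun G : l2 F -> l2 F =>
      hankel G /\
      exists V : H -> l2 F,
        [/\ linear_isometry V,
            @l2_conj F \o G = V \o R \o phi \o J \o adj V,
            @l2_conj F \o (G \o @fshift F) = V \o R1 \o phi1 \o J \o adj V &
            adj G (l2_basis F 0) = V p]) Gamma /\
    (op_ker Gamma = [set 0] <-> `|q| = 1 /\ ~ range R q).
Proof.
move=> T_stable.
have [V [V_iso V_obs]] :=
  observability_isometry Sigma_star_linear Sigma_star_defect T_stable.
exists (model V); split; last first.
  rewrite (model_ker0 V_iso) norm1_sqnorm; split.
    exact: observability_onto_norm V_iso V_obs.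
  by case; exact: norm_observability_onto V_iso V_obs.
split.
  split; first exact: model_hankel V_iso V_obs.
  exists V; split=> //.
  - by apply/funext => u; rewrite /= (conjugationK C_conj).
  - apply/funext => u /=; rewrite (model_fshift V_iso V_obs).
    exact: conjugationK C_conj _.
  - by rewrite adj_model_basis0// adj_observability_basis0// R_phi_J_defect.
move=> G [G_hankel [W [W_iso e1 e2 e3]]].
(* The first identity determines [G] from [W], so it remains to see that [W = V]: both are the
   observability operator. *)
have GE : G = model W.
  apply/funext => u; have /= := congr1 (@^~ u) e1.
  by rewrite /model /A => <-; rewrite (conjugationK C_conj).
rewrite GE in G_hankel e2 e3 *; congr model.
apply/funext => h; apply: l2_ext => k.
by rewrite V_obs (observability_unique W_iso).
Qed.

End SpectralData.

Theorem theorem4p6 (F : realType) (H : hilbertType F)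
    (H_separable : separable_space H)
    (R R1 : H -> H) (p : H) (Jp phi phi1 : H -> H) :
  spectral_data R R1 p Jp phi phi1 ->
  asymptotically_stable (Sigma_star R R1 phi phi1) ->
  exists Gamma : l2 F -> l2 F,
    unique (fun G : l2 F -> l2 F =>
      hankel G /\
      exists V : H -> l2 F,
        [/\ linear_isometry V,
            @l2_conj F \o G = V \o R \o phi \o Jp \o adj V,
            @l2_conj F \o (G \o @fshift F) = V \o R1 \o phi1 \o Jp \o adj V &
            adj G (l2_basis F 0) = V p]) Gamma /\
    (op_ker Gamma = [set 0] <->
      `|inv_op R p| = 1 /\ ~ range R (inv_op R p)).
Proof. exact: spectral_data_hankel. Qed.
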